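(* There is an $O(n)$ algorithm to represent any element $\sigma$ of the alternating group $A_n$ as a commutator $\sigma = [\alpha, \beta]$ of a pair of elements $\alpha, \beta \in S_n$.
   Context: $n$ is a positive integer, $S_n$ is the symmetric group on $\{1, \dots, n\}$, $A_n$ is its subgroup of even permutations, and $[\alpha, \beta] = \alpha \beta \alpha^{-1} \beta^{-1}$. Products of permutations are compositions, with the right factor applied first. Permutations are written in cycle notation. An $O(n)$ algorithm is one whose running time is $O(n)$. *)

(* Defs.v *)
From mathcomp Require Import all_boot all_fingroup all_solvable.

Set Implicit Arguments.
Unset Strict Implicit.
Unset Printing Implicit Defensive.

(** * Permutations *)

(** The product of ['S_n] in MathComp applies its left factor first;
    [pcomp s t] is the composition that applies [t] first. *)
Definition pcomp (n : nat) (s t : 'S_n) : 'S_n := (t * s)%g.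

(** [a b a^-1 b^-1], in terms of [pcomp]. *)
Definition pcommutator (n : nat) (a b : 'S_n) : 'S_n :=
  pcomp a (pcomp b (pcomp a^-1%g b^-1%g)).

(** [cs] writes [s] as a product of disjoint cycles. The cycles and their
    starting points come in any order, and a fixed point of [s] may be either
    omitted or written as a cycle of length 1. *)
Definition cycle_notation (n : nat) (cs : seq (seq 'I_n)) (s : 'S_n) : Prop :=
  [/\ [::] \notin cs,
      uniq (flatten cs),
      forall c, c \in cs -> fcycle s c
    & forall x, x \notin flatten cs -> s x = x].

(** Cycle notation as a word of numbers: the points are written 1, ..., n,
    a 0 closes each cycle, and a further 0 ends the word. For example
    (1 4 2)(3 5) is the word 1 4 2 0 3 5 0 0. *)
Definition code (n : nat) (cs : seq (seq 'I_n)) : seq nat :=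
  rcons (flatten [seq rcons [seq (val x).+1 | x <- c] 0 | c <- cs]) 0.

(** * Random access machines

    A program is a structured program for a random access machine with finitely
    many scalar variables and finitely many arrays, all named by numbers.
    Every elementary operation and every test costs one unit of time. *)
Inductive prog : Type :=
| Skip
| Const of nat & nat          (* Const x k   :  x := k             *)
| Add of nat & nat & nat      (* Add x y z   :  x := y + z         *)
| Sub of nat & nat & nat      (* Sub x y z   :  x := max(y - z, 0) *)
| Read of nat & nat & nat     (* Read x a y  :  x := a[y]          *)
| Write of nat & nat & nat    (* Write a x y :  a[x] := y          *)
| Seq of prog & prog
| If of nat & prog & prog     (* If x p q    :  if x > 0 then p else q *)
| While of nat & prog.        (* While x p   :  while x > 0 do p   *)

Record state : Type := State {
  var : nat -> nat;
  arr : nat -> nat -> nat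
}.

Definition set_var (st : state) (x v : nat) : state :=
  State (fun y => if y == x then v else var st y) (arr st).

Definition set_arr (st : state) (a i v : nat) : state :=
  State (var st)
    (fun b j => if (b == a) && (j == i) then v else arr st b j).

(** [exec w p st t st']: on a machine with words of [w] bits, [p] started in
    state [st] halts after exactly [t] units of time in state [st'].
    An operation whose result does not fit in a word has no transition, so
    unit cost is never charged for arithmetic on long numbers. *)
Inductive exec (w : nat) : prog -> state -> nat -> state -> Prop :=
| ExecSkip st :
    exec w Skip st 1 st
| ExecConst st x k :
    k < 2 ^ w -> exec w (Const x k) st 1 (set_var st x k)
| ExecAdd st x y z :
    var st y + var st z < 2 ^ w ->
    exec w (Add x y z) st 1 (set_var st x (var st y + var st z))
| ExecSub st x y z :
    var st y - var st z < 2 ^ w ->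
    exec w (Sub x y z) st 1 (set_var st x (var st y - var st z))
| ExecRead st x a y :
    arr st a (var st y) < 2 ^ w ->
    exec w (Read x a y) st 1 (set_var st x (arr st a (var st y)))
| ExecWrite st a x y :
    var st y < 2 ^ w ->
    exec w (Write a x y) st 1 (set_arr st a (var st x) (var st y))
| ExecSeq st t1 st1 t2 st2 p q :
    exec w p st t1 st1 -> exec w q st1 t2 st2 ->
    exec w (Seq p q) st (t1 + t2) st2
| ExecIfTrue st x t st' p q :
    0 < var st x -> exec w p st t st' -> exec w (If x p q) st t.+1 st'
| ExecIfFalse st x t st' p q :
    var st x = 0 -> exec w q st t st' -> exec w (If x p q) st t.+1 st'
| ExecWhileTrue st x t1 st1 t2 st2 p :
    0 < var st x -> exec w p st t1 st1 -> exec w (While x p) st1 t2 st2 ->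
    exec w (While x p) st (t1 + t2).+1 st2
| ExecWhileFalse st x p :
    var st x = 0 -> exec w (While x p) st 1 st.

(** Programs are deterministic, so "some run" means "the run". *)
Lemma exec_det (w : nat) (p : prog) (st : state) (t1 t2 : nat)
    (st1 st2 : state) :
  exec w p st t1 st1 -> exec w p st t2 st2 -> t1 = t2 /\ st1 = st2.
Proof.
move=> h; elim: h t2 st2 => {p st t1 st1}.
- by move=> st t2 st2 h; inversion h.
- by move=> st x k _ t2 st2 h; inversion h.
- by move=> st x y z _ t2 st2 h; inversion h.
- by move=> st x y z _ t2 st2 h; inversion h.
- by move=> st x a y _ t2 st2 h; inversion h.
- by move=> st a x y _ t2 st2 h; inversion h.
- move=> st t1 st1 t1' st1' p q _ IHp _ IHq t2 st2 h.
  inversion h as [| | | | | |? u1 s1 u2 s2 ? ? hp hq| | | |]; subst.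
  by have [? ?] := IHp _ _ hp; subst; have [-> ->] := IHq _ _ hq.
- move=> st x t st' p q x0 _ IH t2 st2 h.
  inversion h as [| | | | | | |? ? u s ? ? y0 hp|? ? u s ? ? y0 hq| |]; subst.
    by have [-> ->] := IH _ _ hp.
  by rewrite y0 in x0.
- move=> st x t st' p q x0 _ IH t2 st2 h.
  inversion h as [| | | | | | |? ? u s ? ? y0 hp|? ? u s ? ? y0 hq| |]; subst.
    by rewrite x0 in y0.
  by have [-> ->] := IH _ _ hq.
- move=> st x t1 st1 t1' st1' p x0 _ IHp _ IHw t2 st2 h.
  inversion h as [| | | | | | | | |? ? u1 s1 u2 s2 ? y0 hp hw|? ? ? y0]; subst.
    by have [? ?] := IHp _ _ hp; subst; have [-> ->] := IHw _ _ hw.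
  by rewrite y0 in x0.
- move=> st x p x0 t2 st2 h.
  inversion h as [| | | | | | | | |? ? u1 s1 u2 s2 ? y0 hp hw|? ? ? y0]; subst.
    by rewrite x0 in y0.
  by [].
Qed.

(** The input is [n], in variable 0, and the word [s], in array 0. *)
Definition init_state (n : nat) (s : seq nat) : state :=
  State (fun x => if x == 0 then n else 0)
        (fun a i => if a == 0 then nth 0 s i else 0).

(** Array [a] begins with the word [s]. *)
Definition holds (st : state) (a : nat) (s : seq nat) : Prop :=
  mkseq (arr st a) (size s) = s.

(** The number of binary digits of [n > 0]. *)
Definition bits (n : nat) : nat := (trunc_log 2 n).+1.

(* Main.v *)
Require Import Defs.
From mathcomp Require Import all_boot all_fingroup all_solvable.
From mathcomp Require Import zify.
From Stdlib Require Import FunctionalExtensionality.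

(** [sigma = [alpha, beta]] means that [alpha] conjugates [beta] to
    [sigma beta]. Choose [beta] as an involution that reverses every cycle of
    [sigma]; then [sigma beta] is an involution that reverses the same cycles.
    On a cycle of odd length both have exactly one fixed point. On a cycle of
    even length one of them has two fixed points and the other has none; since
    [sigma] is even, the even cycles can be paired, and giving the two cycles of
    a pair opposite choices makes the cycle types agree.

    For an odd cycle (c_0 ... c_2k) take beta c_i = c_{-i}; then
    alpha = (c_{k+1} ... c_{2k} c_0) works. For a pair (a_0 ... a_{2k-1}),
    (b_0 ... b_{2l-1}) take beta a_i = a_{-i} and beta b_i = b_{1-i}; then
    alpha = (a_{k+1} ... a_{2k-1} a_0 b_1 a_k b_{l+1} ... b_{2l-1} b_0) works.
    All these cycles consist of contiguous runs, read forwards or backwards, so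
    the machine emits them in one pass, remembering one unpaired even cycle. *)

Set Implicit Arguments.
Unset Strict Implicit.
Unset Printing Implicit Defensive.

(** * Reflections of cycles *)

Section Commutator.

Variables (T : eqType) (x0 : T).

(** For [i = size c] this is the head again, so indices may run up to and
    including the length of the cycle. *)
Definition pt (c : seq T) i := nth (head x0 c) c i.

(** For length m and k = floor(m/2) this is the run c_{k+1}, ..., c_m; it ends with the head because
    index m is read as index 0. *)
Definition arc (c : seq T) :=
  [seq pt c i | i <- iota (size c)./2.+1 (uphalf (size c))].

(** The reflection [i |-> s - i] as a list of transpositions. *)
Definition chords (c : seq T) s :=
  [seq [:: pt c i; pt c (s - i)] | i <- iota 1 s.-1./2].

Definition alpha_cycle (bl : seq (seq T)) : seq T :=
  match bl with
  | [:: c] => arc c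
  | [:: a; b] => arc a ++ [:: pt b 1, pt a (size a)./2 & arc b]
  | _ => [::]
  end.

Definition beta_cycles (bl : seq (seq T)) : seq (seq T) :=
  match bl with
  | [:: c] => chords c (size c)
  | [:: a; b] => chords a (size a) ++ chords b (size b).+1
  | _ => [::]
  end.

Definition block (bl : seq (seq T)) : bool :=
  match bl with
  | [:: c] => odd (size c)
  | [:: a; b] => [&& ~~ odd (size a), ~~ odd (size b), 0 < size a & 0 < size b]
  | _ => false
  end.

(** * Indexing the points of a cycle *)

Lemma pt_size c : pt c (size c) = pt c 0.
Proof. by case: c => [|x c] //=; rewrite /pt /= nth_default. Qed.

(** The range 1..m, preferred to 0..m-1 for reflections, enumerates the tail of [c] followed by its
    head, again a list without repetition. *)
Lemma pt_inj c i j : uniq c -> 0 < i <= size c -> 0 < j <= size c ->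
  pt c i = pt c j -> i = j.
Proof.
case: c => [|x c] Uc /=; first by move=> ?; lia.
have Ur : uniq (rcons c x) by rewrite rcons_uniq.
case: i j => [|i] [|j]; rewrite ?ltnS //= => lei lej.
have nthE k : pt (x :: c) k.+1 = nth x (rcons c x) k.
  by rewrite /pt /= nth_rcons; case: ltngtP => // h; rewrite nth_default //; lia.
by rewrite !nthE => /eqP; rewrite nth_uniq ?size_rcons ?ltnS // => /eqP->.
Qed.

Lemma mem_pt c i : 0 < size c -> pt c i \in c.
Proof.
move=> c0; case: (ltnP i (size c)) => [lti|lei]; first by rewrite mem_nth.
by rewrite /pt nth_default //; case: c c0 {lei} => //= x c _; rewrite mem_head.
Qed.

Lemma ptP c x : x \in c -> exists2 i, 0 < i <= size c & x = pt c i.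
Proof.
move=> xc; have lti : index x c < size c by rewrite index_mem.
have xE : x = pt c (index x c) by rewrite /pt nth_index.
case: (posnP (index x c)) xE => [-> ->|i0 ->]; last by exists (index x c) => //; lia.
by exists (size c); [lia | rewrite pt_size].
Qed.

Lemma fcycle_pt f c i : fcycle f c -> i < size c -> f (pt c i) = pt c i.+1.
Proof.
case: c => [|x c] //= /(pathP x) h lti.
have := h i; rewrite size_rcons => /(_ lti) /eqP.
rewrite /pt /= -cats1 -cat_cons !nth_cat /= lti => ->.
case: (ltnP i (size c)) => // lei; rewrite (_ : i = size c); last lia.
by rewrite subnn /= nth_default.
Qed.

Lemma size_arc c : size (arc c) = uphalf (size c).
Proof. by rewrite size_map size_iota. Qed.

Lemma nth_arc y c i : i < uphalf (size c) -> nth y (arc c) i = pt c ((size c)./2.+1 + i).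
Proof. by move=> lti; rewrite (nth_map 0) ?size_iota // nth_iota. Qed.

Lemma arcP x c :
  reflect (exists2 i, (size c)./2 < i <= size c & x = pt c i) (x \in arc c).
Proof.
apply: (iffP mapP) => [[i]|[i lti ->]]; [rewrite mem_iota|];
  exists i; rewrite ?mem_iota //; lia.
Qed.

(** A chord is listed under the smaller of i and [s - i]; the only index strictly between 0 and s
    that lies on no chord is the midpoint. *)
Lemma chordsP x c s :
  reflect (exists2 i, 0 < i < s /\ i.*2 != s & x = pt c i)
    (x \in flatten (chords c s)).
Proof.
apply: (iffP flatten_mapP) => [[i]|[i [lti nei] ->]].
  rewrite mem_iota !inE => lti /orP[]/eqP->; [exists i|exists (s - i)] => //; lia.
case: (ltnP i (s - i)) => h; [exists i|exists (s - i)]; rewrite ?mem_iota ?inE;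
  try by [lia | rewrite eqxx].
by rewrite subKn ?eqxx ?orbT //; lia.
Qed.

Lemma chords_swap (beta : T -> T) c s i :
    {in chords c s, forall p, fcycle beta p} ->
    0 < i < s -> i.*2 != s -> beta (pt c i) = pt c (s - i).
Proof.
move=> H lti nei; case: (ltnP i (s - i)) => h.
  have : [:: pt c i; pt c (s - i)] \in chords c s.
    by apply/mapP; exists i; rewrite ?mem_iota //; lia.
  by move/H => /= /and3P[/eqP].
have : [:: pt c (s - i); pt c i] \in chords c s.
  by apply/mapP; exists (s - i); rewrite ?mem_iota ?subKn //; lia.
by move/H => /= /and3P[_ /eqP].
Qed.

Lemma uniq_chords c s : uniq c -> s <= (size c).+1 -> uniq (flatten (chords c s)).
Proof.
move=> Uc les.
have -> : flatten (chords c s) =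
    map (pt c) (flatten [seq [:: i; s - i] | i <- iota 1 s.-1./2]).
  by rewrite map_flatten -map_comp.
rewrite map_inj_in_uniq => [|i j].
  case: s {les} => // s.
  have : (1 + s.+1.-1./2).*2 <= s.+2 by lia.
  have : 0 < 1 by [].
  (* The start of the range is generalised from 1 to a; [(a + k).*2 <= s.+2] keeps every i of the
     range below its partner [s.+1 - i]. *)
  elim: s.+1.-1./2 {-1}1 => //= k IH a a0 lek.
  rewrite IH ?andbT; try lia.
  rewrite !inE negb_or -andbA; apply/and3P; split; first by lia.
    by apply/flatten_mapP => -[i]; rewrite mem_iota !inE; lia.
  by apply/flatten_mapP => -[i]; rewrite mem_iota !inE; lia.
move=> /flatten_mapP[i' +  +] /flatten_mapP[j' + +].
rewrite !mem_iota !inE => *; apply: (pt_inj Uc) => //; lia.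
Qed.

Lemma uniq_arc c : uniq c -> uniq (arc c).
Proof.
move=> Uc; rewrite map_inj_in_uniq ?iota_uniq // => i j.
rewrite !mem_iota => lti ltj; apply: (pt_inj Uc); lia.
Qed.

Lemma arc_sub c : {subset arc c <= c}.
Proof. by move=> x /arcP[i lti ->]; apply: mem_pt; lia. Qed.

Lemma chords_sub c s : 0 < size c -> {subset flatten (chords c s) <= c}.
Proof. by move=> c0 x /chordsP[i _ ->]; apply: mem_pt. Qed.

Lemma alpha_cycle_sub bl : block bl -> {subset alpha_cycle bl <= flatten bl}.
Proof.
case: bl => [|a [|b []]] //=; first by rewrite cats0 => _; apply: arc_sub.
rewrite cats0 => /and4P[_ _ a0 b0] x; rewrite !(mem_cat, inE).
case/or4P=> [/arc_sub-> //|/eqP->|/eqP->|/arc_sub->]; rewrite ?mem_pt ?orbT //.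
Qed.

Lemma beta_cycles_sub bl : block bl -> {subset flatten (beta_cycles bl) <= flatten bl}.
Proof.
case: bl => [|a [|b []]] //=; first by rewrite cats0 => h; apply: chords_sub; lia.
rewrite cats0 flatten_cat => /and4P[_ _ a0 b0] x; rewrite !mem_cat.
by case/orP=> /chords_sub->; rewrite ?orbT.
Qed.

Lemma alpha_cycle_neq0 bl : block bl -> alpha_cycle bl != [::].
Proof.
case: bl => [|a [|b []]] //=; first by rewrite -size_eq0 size_arc => h; lia.
by rewrite -size_eq0 size_cat /=; lia.
Qed.

Lemma beta_cycles_neq0 bl : [::] \notin beta_cycles bl.
Proof.
have Hc c s : [::] \notin chords c s by apply/mapP => -[].
by case: bl => [|a [|b []]] //=; rewrite mem_cat negb_or !Hc.
Qed.

(** The two inserted points avoid the arcs: [arc a] starts at index k+1, past a_k, and [arc b] at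
    index l+1 >= 2, past b_1. *)
Lemma uniq_alpha_cycle bl : block bl -> uniq (flatten bl) -> uniq (alpha_cycle bl).
Proof.
case: bl => [|a [|b []]] //=; first by rewrite cats0 => _; apply: uniq_arc.
rewrite cats0 => /and4P[oa ob a0 b0]; rewrite cat_uniq => /and3P[Ua Dab Ub].
have dis x : x \in a -> x \in b -> False.
  by move=> xa xb; case/hasP: Dab; exists x.
have Npa : pt a (size a)./2 \notin arc a.
  apply/arcP => -[i lti /(pt_inj Ua)]; lia.
have Npb : pt b 1 \notin arc b.
  apply/arcP => -[i lti /(pt_inj Ub)]; lia.
have pa i := mem_pt i a0; have pb i := mem_pt i b0.
rewrite cat_uniq /= !uniq_arc // !inE !negb_or Npa Npb !andbT /=.
apply/and3P; split.
- apply/andP; split; first by apply/negP => /arc_sub /dis; apply.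
  by apply/hasP => -[x /arc_sub xb /arc_sub xa]; exact: dis xa xb.
- by apply/eqP => e; apply: (@dis (pt b 1)); rewrite ?pb // e pa.
- by apply/negP => /arc_sub /(dis _ (pa _)).
Qed.

Lemma uniq_beta_cycles bl : block bl -> uniq (flatten bl) -> uniq (flatten (beta_cycles bl)).
Proof.
case: bl => [|a [|b []]] //=; first by rewrite cats0 => _ U; apply: uniq_chords.
rewrite cats0 => /and4P[oa ob a0 b0]; rewrite cat_uniq => /and3P[Ua Dab Ub].
rewrite flatten_cat cat_uniq !uniq_chords // andbT /=.
by apply/hasP => -[x /chords_sub xb /chords_sub xa]; case/hasP: Dab; exists x; auto.
Qed.


(** * Commutator identities on one block *)

(** The two admissible values of s are the two kinds of reflection. For s = m the head, at index m,
    goes to index 0, which is the same point, so it is fixed like the midpoint. *)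
Lemma chords_reflect (beta : T -> T) c s i :
    uniq c -> size c <= s <= (size c).+1 ->
    {in chords c s, forall p, fcycle beta p} ->
    {in c, forall x, x \notin flatten (chords c s) -> beta x = x} ->
    0 < i <= size c -> beta (pt c i) = pt c (s - i).
Proof.
move=> Uc les bC bF lti; have c0 : 0 < size c by lia.
case: (eqVneq i.*2 s) => [e|ne].
  rewrite bF ?mem_pt //; first by congr pt; lia.
  by apply/chordsP => -[j [ltj nej] /(pt_inj Uc)]; lia.
case: (eqVneq i s) => [e|ne']; last by apply: chords_swap bC _ ne; lia.
rewrite bF ?mem_pt //; first by rewrite e subnn -pt_size; congr pt; lia.
by apply/chordsP => -[j [ltj nej] /(pt_inj Uc)]; lia.
Qed.

(** The commutator identity in the inverse-free form sigma beta alpha = alpha beta. With m = 2k+1,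
    alpha fixes c_1, ..., c_k and raises later indices by one, closing up at c_{k+1}. Both sides
    send index i <= k to m-i+1, k < i < m to m-i, and m to k+1. *)
Lemma odd_cycle_commutator (sigma alpha beta : T -> T) c :
    odd (size c) -> uniq c ->
    fcycle sigma c -> fcycle alpha (arc c) ->
    {in c, forall x, x \notin arc c -> alpha x = x} ->
    {in chords c (size c), forall p, fcycle beta p} ->
    {in c, forall x, x \notin flatten (chords c (size c)) -> beta x = x} ->
  {in c, forall x, sigma (beta (alpha x)) = alpha (beta x)}.
Proof.
move=> oc Uc sC aC aF bC bF.
have S i : i < size c -> sigma (pt c i) = pt c i.+1 by exact: fcycle_pt.
have c0 : 0 < size c by lia.
have aL i : 0 < i <= (size c)./2 -> alpha (pt c i) = pt c i.
  move=> lti; apply: aF; first exact: mem_pt.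
  by apply/arcP => -[j ltj] /(pt_inj Uc); lia.
have aR i : (size c)./2 < i < size c -> alpha (pt c i) = pt c i.+1.
  move=> lti; have := @fcycle_pt _ _ (i - (size c)./2.+1) aC.
  rewrite size_arc /pt -/(arc c) !nth_arc; try lia.
  by rewrite addnS subnKC; last lia; apply; lia.
have aT : alpha (pt c (size c)) = pt c (size c)./2.+1.
  have <- : pt (arc c) (size (arc c)) = pt c (size c)./2.+1.
    by rewrite pt_size /pt nth_arc ?addn0 //; lia.
  have <- : pt (arc c) (size c)./2 = pt c (size c).
    by rewrite /pt nth_arc; [congr pt|]; lia.
  by rewrite (fcycle_pt aC) size_arc; [congr pt|]; lia.
have bE i : 0 < i <= size c -> beta (pt c i) = pt c (size c - i).
  by apply: chords_reflect bF => //; lia.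
move=> x /ptP[i lti ->].
case: (ltngtP i (size c)) lti => [ltim|ltim|->] lti; [|lia|].
  rewrite bE; last lia.
  case: (leqP i (size c)./2) => leik.
    by rewrite aL ?bE ?S ?aR; try lia; congr pt; lia.
  by rewrite aR ?bE ?S ?aL; try lia; congr pt; lia.
by rewrite aT !bE ?S ?subnn -?pt_size ?aT; try lia; congr pt; lia.
Qed.

(** Here alpha carries the cycles of beta to those of sigma beta: the fixed points a_0, a_k of beta
    go to b_1, b_{l+1}, fixed by sigma beta, and the points b_1, b_0 swapped by beta go to a_k,
    a_{k+1}, swapped by sigma beta. Elsewhere alpha fixes or raises indices as on an odd cycle. *)
Lemma even_cycles_commutator (sigma alpha beta : T -> T) a b :
    ~~ odd (size a) -> ~~ odd (size b) -> 0 < size a -> 0 < size b ->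
    uniq a -> uniq b ->
    fcycle sigma a -> fcycle sigma b ->
    fcycle alpha (alpha_cycle [:: a; b]) ->
    {in a ++ b, forall x, x \notin alpha_cycle [:: a; b] -> alpha x = x} ->
    {in chords a (size a) ++ chords b (size b).+1, forall p, fcycle beta p} ->
    {in a, forall x, x \notin flatten (chords a (size a)) -> beta x = x} ->
    {in b, forall x, x \notin flatten (chords b (size b).+1) -> beta x = x} ->
    {in a, forall x, x \notin b} ->
  {in a ++ b, forall x, sigma (beta (alpha x)) = alpha (beta x)}.
Proof.
move=> oa ob a0 b0 Ua Ub sA sB aC aF bC bFa bFb Dab.
have SA i : i < size a -> sigma (pt a i) = pt a i.+1 by exact: fcycle_pt.
have SB i : i < size b -> sigma (pt b i) = pt b i.+1 by exact: fcycle_pt.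
have pa i := mem_pt i a0; have pb i := mem_pt i b0.
have dis x : x \in a -> x \in b -> False.
  by move=> xa; apply/negP/Dab.
have bA i : 0 < i <= size a -> beta (pt a i) = pt a (size a - i).
  apply: chords_reflect bFa => //; first lia.
  by move=> p pC; apply: bC; rewrite mem_cat pC.
have bB i : 0 < i <= size b -> beta (pt b i) = pt b ((size b).+1 - i).
  apply: chords_reflect bFb => //; first lia.
  by move=> p pC; apply: bC; rewrite mem_cat pC orbT.
have aAL i : 0 < i < (size a)./2 -> alpha (pt a i) = pt a i.
  move=> lti; apply: aF; rewrite ?mem_cat ?pa // !inE !negb_or.
  apply/and4P; split.
  - by apply/arcP => -[j ltj] /(pt_inj Ua); lia.
  - by apply/eqP => e; move: (pa i); rewrite e => /dis; apply.
  - by apply/eqP => /(pt_inj Ua); lia.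
  - by apply/negP => /arc_sub; apply: dis.
have aBL i : 1 < i <= (size b)./2 -> alpha (pt b i) = pt b i.
  move=> lti; apply: aF; rewrite ?mem_cat ?pb ?orbT // !inE !negb_or.
  apply/and4P; split.
  - by apply/negP => /arc_sub /dis; apply.
  - by apply/eqP => /(pt_inj Ub); lia.
  - by apply/eqP => e; apply: (dis (pt b i)); rewrite ?pb // e.
  - by apply/arcP => -[j ltj] /(pt_inj Ub); lia.
set L := alpha_cycle _ in aC.
have sL : size L = (size a)./2 + (size b)./2.+2.
  by rewrite size_cat /= !size_arc; lia.
have ua : uphalf (size a) = (size a)./2 by lia.
have nthL y i : nth y L i = if i < (size a)./2 then nth y (arc a) i
    else nth y [:: pt b 1, pt a (size a)./2 & arc b] (i - (size a)./2).
  by rewrite nth_cat size_arc ua.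
(* The runs of [L] by index: [arc a] from 0, b_1 at k, a_k at k+1, [arc b] from k+2; index [size L]
   is a_{k+1} again. *)
have LA i : (size a)./2 < i <= size a -> pt L (i - (size a)./2.+1) = pt a i.
  move=> lti; rewrite {1}/pt nthL ifT ?nth_arc; try lia.
  by rewrite subnKC //; lia.
have L1 : pt L (size a)./2 = pt b 1 by rewrite {1}/pt nthL ltnn subnn.
have L2 : pt L (size a)./2.+1 = pt a (size a)./2.
  by rewrite {1}/pt nthL ltnNge leqnSn subSnn.
have LB i : (size b)./2 < i <= size b ->
    pt L (i - (size b)./2.+1 + (size a)./2.+2) = pt b i.
  move=> lti; rewrite {1}/pt nthL ifF; last lia.
  rewrite !addnS -!addSn addnK /= nth_arc; last lia.
  by rewrite subnKC //; lia.
have LE : pt L (size L) = pt a (size a)./2.+1.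
  by rewrite pt_size -(LA _.+1) ?subnn //; lia.
have next i : i < size L -> alpha (pt L i) = pt L i.+1 by exact: fcycle_pt.
have aAR i : (size a)./2 < i < size a -> alpha (pt a i) = pt a i.+1.
  by move=> lti; rewrite -!LA ?next; try lia; congr pt; lia.
have aA0 : alpha (pt a (size a)) = pt b 1.
  by rewrite -LA ?next -?L1; try lia; congr pt; lia.
have aB1 : alpha (pt b 1) = pt a (size a)./2.
  by rewrite -L1 next ?L2 //; lia.
have aAk : alpha (pt a (size a)./2) = pt b (size b)./2.+1.
  by rewrite -L2 next -?LB; try lia; congr pt; lia.
have aBR i : (size b)./2 < i < size b -> alpha (pt b i) = pt b i.+1.
  by move=> lti; rewrite -!LB ?next; try lia; congr pt; lia.
have aB0 : alpha (pt b (size b)) = pt a (size a)./2.+1.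
  by rewrite -LB ?next -?LE; try lia; congr pt; lia.
move=> x; rewrite mem_cat => /orP[] /ptP[i lti ->].
  case: (ltngtP i (size a)) lti => [ltim|ltim|->] lti; [|lia|]; last first.
    rewrite aA0 bA ?subnn -?pt_size ?aA0 ?bB ?subn1 ?pt_size ?SB //; lia.
  rewrite bA; last lia.
  case: (ltngtP i (size a)./2) => [ltik|ltik|->].
  - by rewrite aAL ?bA ?SA ?aAR; try lia; congr pt; lia.
  - by rewrite aAR ?bA ?SA ?aAL; try lia; congr pt; lia.
  - rewrite (_ : size a - _ = (size a)./2); last lia.
    by rewrite !aAk bB ?SB; try lia; congr pt; lia.
case: (ltngtP i (size b)) lti => [ltim|ltim|->] lti; [|lia|]; last first.
  rewrite aB0 bA ?SA ?bB; try lia.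
  rewrite (_ : _.+1 - size b = 1) ?aB1; last lia.
  by congr pt; lia.
rewrite bB; last lia.
case: (ltngtP i 1) lti => [|lt1i|->] lti; first by lia.
  case: (leqP i (size b)./2) => leik.
    by rewrite aBL ?bB ?SB ?aBR; try lia; congr pt; lia.
  by rewrite aBR ?bB ?SB ?aBL; try lia; congr pt; lia.
rewrite aB1 bA ?subn1 /= ?aB0 ?SA; try lia.
by congr pt; lia.
Qed.

Lemma block_commutator (sigma alpha beta : T -> T) bl :
    block bl -> uniq (flatten bl) ->
    {in bl, forall c, fcycle sigma c} ->
    fcycle alpha (alpha_cycle bl) ->
    {in flatten bl, forall x, x \notin alpha_cycle bl -> alpha x = x} ->
    {in beta_cycles bl, forall c, fcycle beta c} ->
    {in flatten bl, forall x, x \notin flatten (beta_cycles bl) -> beta x = x} ->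
  {in flatten bl, forall x, sigma (beta (alpha x)) = alpha (beta x)}.
Proof.
case: bl => [|a [|b []]] //.
  rewrite /= cats0 => oc Uc /(_ a (mem_head _ _)) sC.
  exact: odd_cycle_commutator.
rewrite [flatten _]/= cats0 => /and4P[oa ob a0 b0].
rewrite cat_uniq => /and3P[Ua Dab Ub] sC aC aF bC bF.
have {}Dab : {in a, forall x, x \notin b}.
  by move=> x xa; apply/negP => xb; case/hasP: Dab; exists x.
have [sA sB] : fcycle sigma a /\ fcycle sigma b.
  by split; apply: sC; rewrite !inE eqxx ?orbT.
apply: even_cycles_commutator => // x xc xN; apply: bF;
  rewrite ?mem_cat ?xc ?orbT //= flatten_cat mem_cat negb_or xN ?andbT //=.
  by apply/negP => /chords_sub => /(_ b0); apply/negP/Dab.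
by apply/negP => /chords_sub => /(_ a0) /Dab; rewrite xc.
Qed.

(** * Grouping the cycles into blocks *)

(** [p] is an even cycle still waiting for a partner; one left over at the end
    is dropped, which cannot happen for an even permutation. *)
Fixpoint blocks (p : option (seq T)) (cs : seq (seq T)) : seq (seq (seq T)) :=
  match cs with
  | [::] => [::]
  | c :: cs' =>
    if odd (size c) then [:: c] :: blocks p cs'
    else if p is Some a then [:: a; c] :: blocks None cs'
    else blocks (Some c) cs'
  end.

Definition even_cycle (c : seq T) := ~~ odd (size c) && (0 < size c).

Lemma all_block p cs :
  [::] \notin cs -> (if p is Some a then even_cycle a else true) ->
  all block (blocks p cs).
Proof.
elim: cs p => //= c cs IH p; rewrite inE negb_or => /andP[c0 cs0] pE.
have {}c0 : 0 < size c by rewrite lt0n size_eq0 eq_sym.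
case: ifP => oc /=; first by rewrite oc IH.
case: p pE => [a /andP[oa a0]|_]; last by rewrite IH // /even_cycle oc.
by rewrite /= oa oc a0 c0 IH.
Qed.

(** By the parity hypothesis a cycle is pending exactly when an odd number of even cycles remains,
    so every even cycle finds a partner and none is dropped. *)
Lemma perm_blocks p cs :
  odd (count (fun c => ~~ odd (size c)) cs) = isSome p ->
  perm_eq (flatten (blocks p cs)) (if p is Some a then a :: cs else cs).
Proof.
elim: cs p => [|c cs IH] [a|] //=; case: ifP => oc //= hc.
- rewrite (perm_trans (_ : perm_eq _ (c :: a :: cs))) ?perm_cons ?IH //.
  by rewrite -(cat1s c) -(cat1s a) perm_catCA.
- by rewrite !perm_cons IH //; move: hc; case: odd.
- by rewrite perm_cons IH.
- by rewrite IH //; move: hc; case: odd.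
Qed.

(** Gives disjointness of the output cycles: those of alpha and beta stay inside their own blocks,
    and the blocks are disjoint. *)
Lemma uniq_flatten_sub (U : eqType) (F G : U -> seq T) (s : seq U) :
    {in s, forall u, uniq (G u) -> uniq (F u)} ->
    {in s, forall u, {subset F u <= G u}} ->
  uniq (flatten (map G s)) -> uniq (flatten (map F s)).
Proof.
elim: s => //= u s IH UF FG; rewrite !cat_uniq => /and3P[Uu D Us].
rewrite UF ?mem_head // IH //; first last.
- by move=> v vs; apply: FG; rewrite inE vs orbT.
- by move=> v vs; apply: UF; rewrite inE vs orbT.
rewrite andbT /=; apply/hasP => -[x /flatten_mapP[v vs xv] xu].
case/hasP: D; exists x; last by apply: FG xu; rewrite mem_head.
by apply/flatten_mapP; exists v => //; apply: FG xv; rewrite inE vs orbT.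
Qed.

Lemma uniq_flatten_eq (U : eqType) (G : U -> seq T) (s : seq U) u v x :
  uniq (flatten (map G s)) -> u \in s -> v \in s ->
  x \in G u -> x \in G v -> u = v.
Proof.
elim: s => //= w s IH; rewrite cat_uniq !inE => /and3P[_ D Us].
have Dw z : z \in s -> x \in G z -> x \in G w -> False.
  move=> zs xz xw; case/hasP: D; exists x => //.
  by apply/flatten_mapP; exists z.
case/orP=> [/eqP->|us]; case/orP=> [/eqP->|vs] // xu xv.
- by case: (Dw v).
- by case: (Dw u).
- exact: IH.
Qed.

End Commutator.

(** * Permutations from lists of disjoint cycles *)

Lemma flatten_map_flatten (T : Type) (s : seq (seq (seq T))) :
  flatten (map flatten s) = flatten (flatten s).
Proof. by elim: s => //= x s ->; rewrite flatten_cat. Qed.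

Lemma uniq_mem_flatten (T : eqType) (ss : seq (seq T)) s :
  uniq (flatten ss) -> s \in ss -> uniq s.
Proof.
elim: ss => //= t ss IH; rewrite cat_uniq inE => /and3P[Ut _ Uss].
by case/orP=> [/eqP->|/IH->].
Qed.

(** Putting x in front of a cycle (y ...) means following the permutation by the transposition of x
    and y; this flips the sign, and also the parity of the length of that cycle. The lemma both
    produces alpha and beta from their cycles and counts the even cycles of sigma modulo 2. *)
Lemma cycle_notation_perm n (cs : seq (seq 'I_n)) :
  [::] \notin cs -> uniq (flatten cs) ->
  exists2 s : 'S_n, cycle_notation cs s
    & odd_perm s = odd (count (fun c => ~~ odd (size c)) cs).
Proof.
elim: cs => [|c cs IHcs].
  by exists 1%g; [split=> // x _; rewrite perm1 | rewrite odd_perm1].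
rewrite inE negb_or => /andP[c0 cs0].
elim: c c0 => [|x c IHc] // _.
case: c IHc => [_|y c IHc].
  rewrite /= => /andP[xN Ucs]; have [s [_ _ sc sf] so] := IHcs cs0 Ucs.
  exists s; last by [].
  split=> /=; rewrite ?inE ?xN //.
  - by move=> c; rewrite inE => /orP[/eqP->|/sc] //; rewrite /= sf ?eqxx.
  - by move=> z; rewrite inE negb_or => /andP[_ /sf].
move=> U; have /andP[xN U'] :
    (x \notin flatten ((y :: c) :: cs)) && uniq (flatten ((y :: c) :: cs)) by [].
have [s [_ _ sc sf] so] := IHc isT U'.
have xy : x != y by apply: contraNneq xN => ->; rewrite /= mem_head.
have fE z : (s * tperm x y)%g z = tperm x y (s z) by rewrite permM.
exists (s * tperm x y)%g; last first.
  rewrite odd_permM odd_tperm xy so /= !oddD !oddb /=.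
  by case: (odd (size c)); case: (odd (count _ _)).
have sx : s x = x by apply: sf.
move: (s * tperm x y)%g fE => f fE.
split; [by rewrite inE negb_or cs0 | exact: U | |].
- move=> d; rewrite inE => /orP[/eqP->|dcs].
    have : path (frel s) y (rcons c y) by exact: (sc _ (mem_head _ _)).
    rewrite rcons_path => /andP[/(pathP x) sp /eqP sl].
    change ((f x == y) && path (frel f) y (rcons c x)).
    (* Only two links change: x, fixed by [s], now goes to y, and the last point, which went to y,
       now goes to x. *)
    rewrite fE sx tpermL eqxx rcons_path andTb; apply/andP; split; last first.
      by change (f (last y c) == x); rewrite fE sl tpermR.
    apply/(pathP x) => i lti; change (f (nth x (y :: c) i) == nth x c i).
    have sE : s (nth x (y :: c) i) = nth x c i by exact/eqP/(sp i lti).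
    rewrite fE sE; apply/eqP.
    have cN := mem_nth x lti; rewrite tpermD //.
      by apply: contraNneq xN => ->; rewrite /= inE mem_cat cN orbT.
    apply: contraTneq cN => <-.
    by case/andP: U' => /=; rewrite mem_cat negb_or => /andP[].
  have Ud : uniq d.
    apply: uniq_mem_flatten dcs.
    by move: U'; rewrite /= cat_uniq => /andP[_ /and3P[]].
  have dc := sc d; rewrite inE dcs orbT in dc.
  apply: cycle_from_next => // z zd; change (f z == next d z).
  have sE : s z = next d z by exact/eqP/(next_cycle (dc isT) zd).
  rewrite fE sE; apply/eqP; apply: tpermD; apply/eqP => e.
    case/negP: xN; apply/flattenP; exists d; first by rewrite inE dcs orbT.
    by rewrite e mem_next.
  have /negP[] : y \notin c ++ flatten cs by case/andP: U'.
  rewrite mem_cat; apply/orP; right.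
  by apply/flattenP; exists d; rewrite // e mem_next.
- move=> z; rewrite inE negb_or => /andP[zx zN]; rewrite fE sf //.
  by rewrite tpermD // eq_sym //; apply: contraNneq zN => ->; rewrite mem_head.
Qed.

Lemma cycle_notation_inj n (cs : seq (seq 'I_n)) (s t : 'S_n) :
  cycle_notation cs s -> cycle_notation cs t -> s = t.
Proof.
move=> [_ _ sc sf] [_ _ tc tf]; apply/permP => x.
case: (boolP (x \in flatten cs)) => [/flattenP[c cin xc]|xN]; last by rewrite sf ?tf.
by rewrite (eqP (next_cycle (sc _ cin) xc)) (eqP (next_cycle (tc _ cin) xc)).
Qed.

Definition alpha_cycles (T : eqType) (x0 : T) cs :=
  [seq alpha_cycle x0 bl | bl <- blocks None cs].

Definition all_beta_cycles (T : eqType) (x0 : T) cs :=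
  flatten [seq beta_cycles x0 bl | bl <- blocks None cs].

Lemma cycle_notation_commutator n (x0 : 'I_n) (sigma : 'S_n) cs :
    (sigma \in 'Alt_('I_n))%g -> cycle_notation cs sigma ->
  exists alpha beta : 'S_n,
    [/\ cycle_notation (alpha_cycles x0 cs) alpha,
        cycle_notation (all_beta_cycles x0 cs) beta
      & sigma = pcommutator alpha beta].
Proof.
rewrite Alt_even => sigma_even csP; have [cs0 Ucs sc sf] := csP.
have [s sP] := cycle_notation_perm cs0 Ucs.
rewrite (cycle_notation_inj sP csP) (negbTE sigma_even) => /esym cs_even.
set bs := blocks None cs.
have bsP : all (@block _) bs by apply: all_block.
have bs_cs : perm_eq (flatten bs) cs by apply: perm_blocks; rewrite cs_even.
have fl_cs : perm_eq (flatten (map flatten bs)) (flatten cs).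
  by rewrite flatten_map_flatten; apply: perm_flatten.
have Ubs : uniq (flatten (map flatten bs)) by rewrite (perm_uniq fl_cs).
have Ubl bl : bl \in bs -> uniq (flatten bl).
  by move=> blin; apply: uniq_mem_flatten Ubs (map_f _ blin).
have perm_of ds : [::] \notin ds -> uniq (flatten ds) ->
    exists a : 'S_n, cycle_notation ds a.
  by move=> ds0 Uds; have [a aP _] := cycle_notation_perm ds0 Uds; exists a.
have [alpha aP] : exists a : 'S_n, cycle_notation (alpha_cycles x0 cs) a.
  apply: perm_of.
    by apply/mapP => -[bl /(allP bsP) blP] /esym/eqP; apply/negP/alpha_cycle_neq0.
  apply: uniq_flatten_sub Ubs => bl /(allP bsP).
    exact: uniq_alpha_cycle.
  exact: alpha_cycle_sub.
have flB : flatten (all_beta_cycles x0 cs) = flatten [seq flatten (beta_cycles x0 bl) | bl <- bs].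
  by rewrite /all_beta_cycles -flatten_map_flatten -map_comp.
have [beta bP] : exists b : 'S_n, cycle_notation (all_beta_cycles x0 cs) b.
  apply: perm_of.
    by apply/flatten_mapP => -[bl _]; apply/negP/beta_cycles_neq0.
  rewrite flB; apply: uniq_flatten_sub Ubs => bl /(allP bsP).
    exact: uniq_beta_cycles.
  exact: beta_cycles_sub.
exists alpha, beta; split=> //.
have [_ _ ac af] := aP; have [_ _ bc bf] := bP.
(* Checked block by block; a point on no cycle is fixed by all three permutations. *)
have comm x : sigma (beta (alpha x)) = alpha (beta x).
  case: (boolP (x \in flatten cs)) => [|xN].
    rewrite -(perm_mem fl_cs) => /flatten_mapP[bl blin xbl].
    have blP := allP bsP bl blin.
    apply: (@block_commutator _ x0 sigma alpha beta bl) => //.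
    - exact: Ubl.
    - by move=> c cbl; apply: sc; rewrite -(perm_mem bs_cs); apply/flattenP; exists bl.
    - by apply: ac; apply: map_f.
    (* A cycle of alpha through y would come from a block containing y, which by disjointness is
       [bl] itself. *)
    - move=> y ybl yN; apply: af; apply/flatten_mapP => -[bl' bl'in ybl'].
      suff e : bl = bl' by rewrite e ybl' in yN.
      apply: (uniq_flatten_eq Ubs blin bl'in ybl).
      by apply: alpha_cycle_sub ybl'; apply: (allP bsP).
    - by move=> c cbl; apply: bc; apply/flatten_mapP; exists bl.
    - move=> y ybl yN; apply: bf; rewrite flB; apply/flatten_mapP => -[bl' bl'in ybl'].
      suff e : bl = bl' by rewrite e ybl' in yN.
      apply: (uniq_flatten_eq Ubs blin bl'in ybl).
      by apply: beta_cycles_sub ybl'; apply: (allP bsP).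
  have xN' bl : bl \in bs -> x \notin flatten bl.
    move=> blin; apply: contra xN => xbl; rewrite -(perm_mem fl_cs).
    by apply/flatten_mapP; exists bl.
  have aE : alpha x = x.
    apply: af; apply/flatten_mapP => -[bl blin xbl]; case/negP: (xN' _ blin).
    by apply: alpha_cycle_sub xbl; apply: (allP bsP).
  have bE : beta x = x.
    apply: bf; rewrite flB; apply/flatten_mapP => -[bl blin xbl]; case/negP: (xN' _ blin).
    by apply: beta_cycles_sub xbl; apply: (allP bsP).
  by rewrite aE bE aE sf.
apply/permP => x; rewrite /pcommutator /pcomp !permM.
(* [comm] is used at alpha^-1 (beta^-1 x), where the inverses cancel. *)
by rewrite -comm !permKV.
Qed.

(** * The machine *)

(* MathComp's [Sub] would otherwise hide the instruction. *)
Import Defs.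

(** With finite lists, updates compute. Whatever lies beyond the lists reads as 0, its value in the
    initial state. *)
Definition st (vs : seq nat) (ws : seq (seq nat)) : state :=
  State (nth 0 vs) (fun a => nth 0 (nth [::] ws a)).

Lemma set_var_st vs ws x v : set_var (st vs ws) x v = st (set_nth 0 vs x v) ws.
Proof.
rewrite /set_var /st; congr State; apply: functional_extensionality => y.
by rewrite nth_set_nth.
Qed.

Lemma set_arr_st vs ws a i v :
  set_arr (st vs ws) a i v =
  st vs (set_nth [::] ws a (set_nth 0 (nth [::] ws a) i v)).
Proof.
rewrite /set_arr /st; congr State.
apply: functional_extensionality => b; apply: functional_extensionality => j.
rewrite nth_set_nth /=; case: eqP => [->|] //=.
by rewrite nth_set_nth /=.
Qed.

Definition blk (ps : seq prog) : prog := foldr Seq Skip ps.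

(** * Time-bounded execution of programs *)

Section Runs.

Variable w : nat.

(** A total-correctness triple. Time is bounded from above, not exact, so that both branches of a
    test can share one figure. *)
Definition runs p s T (Q : state -> Prop) :=
  exists t s', [/\ exec w p s t s', t <= T & Q s'].

Lemma runs_le p s T T' Q : runs p s T Q -> T <= T' -> runs p s T' Q.
Proof. by move=> [t [s' [? tT ?]]] TT'; exists t, s'; split=> //; apply: leq_trans TT'. Qed.

Lemma runs_imp p s T (Q Q' : state -> Prop) :
  runs p s T Q -> (forall s', Q s' -> Q' s') -> runs p s T Q'.
Proof. by move=> [t [s' [? ? Qs]]] /(_ _ Qs); exists t, s'. Qed.

Lemma runs_nil s (Q : state -> Prop) : Q s -> runs (blk [::]) s 1 Q.
Proof. by move=> Qs; exists 1, s; split=> //; apply: ExecSkip. Qed.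

Lemma runs_cons p l s T1 T2 (R Q : state -> Prop) :
    runs p s T1 R -> (forall s1, R s1 -> runs (blk l) s1 T2 Q) ->
  runs (blk (p :: l)) s (T1 + T2) Q.
Proof.
move=> [t1 [s1 [e1 le1 R1]]] /(_ _ R1)[t2 [s2 [e2 le2 Q2]]].
exists (t1 + t2), s2; split; [exact: ExecSeq e1 e2 | exact: leq_add | by []].
Qed.

Lemma runs_step p l s s1 T Q :
  exec w p s 1 s1 -> runs (blk l) s1 T Q -> runs (blk (p :: l)) s T.+1 Q.
Proof.
move=> e r; rewrite -add1n; apply: (runs_cons (R := eq s1)); last by move=> _ <-.
by exists 1, s1.
Qed.

(** This rule and the next four carry the rest of the block as a continuation, so that applying them
    in turn executes a block symbolically; the side conditions are the word-size requirements. *)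
Lemma runs_const x k l vs ws T Q : k < 2 ^ w ->
  runs (blk l) (st (set_nth 0 vs x k) ws) T Q ->
  runs (blk (Const x k :: l)) (st vs ws) T.+1 Q.
Proof. by move=> ltk; apply: runs_step; rewrite -set_var_st; apply: ExecConst. Qed.

Lemma runs_add x y z l vs ws T Q : nth 0 vs y + nth 0 vs z < 2 ^ w ->
  runs (blk l) (st (set_nth 0 vs x (nth 0 vs y + nth 0 vs z)) ws) T Q ->
  runs (blk (Add x y z :: l)) (st vs ws) T.+1 Q.
Proof. by move=> ltk; apply: runs_step; rewrite -set_var_st; apply: ExecAdd. Qed.

Lemma runs_sub x y z l vs ws T Q : nth 0 vs y - nth 0 vs z < 2 ^ w ->
  runs (blk l) (st (set_nth 0 vs x (nth 0 vs y - nth 0 vs z)) ws) T Q ->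
  runs (blk (Sub x y z :: l)) (st vs ws) T.+1 Q.
Proof. by move=> ltk; apply: runs_step; rewrite -set_var_st; apply: ExecSub. Qed.

Lemma runs_read x a y l vs ws T Q :
  nth 0 (nth [::] ws a) (nth 0 vs y) < 2 ^ w ->
  runs (blk l) (st (set_nth 0 vs x (nth 0 (nth [::] ws a) (nth 0 vs y))) ws) T Q ->
  runs (blk (Read x a y :: l)) (st vs ws) T.+1 Q.
Proof. by move=> ltk; apply: runs_step; rewrite -set_var_st; apply: ExecRead. Qed.

Lemma runs_write a x y l vs ws T Q : nth 0 vs y < 2 ^ w ->
  runs (blk l) (st vs (set_nth [::] ws a
    (set_nth 0 (nth [::] ws a) (nth 0 vs x) (nth 0 vs y)))) T Q ->
  runs (blk (Write a x y :: l)) (st vs ws) T.+1 Q.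
Proof. by move=> ltk; apply: runs_step; rewrite -set_arr_st; apply: ExecWrite. Qed.

Lemma runs_if x p q vs ws T Q :
  (0 < nth 0 vs x -> runs p (st vs ws) T Q) ->
  (nth 0 vs x = 0 -> runs q (st vs ws) T Q) ->
  runs (If x p q) (st vs ws) T.+1 Q.
Proof.
move=> hp hq; case: (posnP (nth 0 vs x)) => [x0|x0].
  by have [t [s' [e le Qs]]] := hq x0; exists t.+1, s'; split=> //; apply: ExecIfFalse.
by have [t [s' [e le Qs]]] := hp x0; exists t.+1, s'; split=> //; apply: ExecIfTrue.
Qed.

Lemma runs_while x p vs ws T1 T2 (R Q : state -> Prop) :
  0 < nth 0 vs x -> runs p (st vs ws) T1 R ->
  (forall s1, R s1 -> runs (While x p) s1 T2 Q) ->
  runs (While x p) (st vs ws) (T1 + T2).+1 Q.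
Proof.
move=> x0 [t1 [s1 [e1 le1 R1]]] /(_ _ R1)[t2 [s2 [e2 le2 Q2]]].
exists (t1 + t2).+1, s2; split=> //; last by rewrite ltnS leq_add.
exact: ExecWhileTrue e1 e2.
Qed.

Lemma runs_while0 x p vs ws (Q : state -> Prop) :
  nth 0 vs x = 0 -> Q (st vs ws) -> runs (While x p) (st vs ws) 1 Q.
Proof. by move=> x0 Qs; exists 1, (st vs ws); split=> //; apply: ExecWhileFalse. Qed.

End Runs.

(** * The program *)

(* Scalar variables:
   0: n                      5: length of array 2      10: start of the pending cycle
   1: the constant 1         6: start of the cycle     11: middle of the pending cycle
   2: input position         7: middle of the cycle    12, 13: positions to be copied
   3: current letter         8: parity of its length   14: loop counter
   4: length of array 1      9: is a cycle pending? *)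
Definition pushA x := blk [:: Read 3 0 x; Write 1 4 3; Add 4 4 1].
Definition pushB x := blk [:: Read 3 0 x; Write 2 5 3; Add 5 5 1].
Definition closeA := blk [:: Const 3 0; Write 1 4 3; Add 4 4 1].
Definition closeB := blk [:: Const 3 0; Write 2 5 3; Add 5 5 1].

Definition copy_range :=
  While 14 (blk [:: pushA 12; Add 12 12 1; Sub 14 14 1]).

Definition copy_pairs :=
  While 14 (blk [:: pushB 12; pushB 13; closeB;
                    Add 12 12 1; Sub 13 13 1; Sub 14 14 1]).

(** Halving without division: variable 8 toggles at each letter, and variable 7 advances only at
    every second one. *)
Definition scan_cycle :=
  While 3 (blk [:: Add 2 2 1;
                   If 8 (blk [:: Add 7 7 1; Const 8 0]) (blk [:: Const 8 1]);
                   Read 3 0 2]).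

Definition odd_cycle :=
  blk [:: Add 12 7 1; Sub 14 7 6; copy_range; pushA 6; closeA;
          Add 12 6 1; Sub 13 2 1; Sub 14 7 6; copy_pairs].

(** Variable 8 is 0 in this branch, so the additions are plain copies. *)
Definition even_cycle1 := blk [:: Add 10 6 8; Add 11 7 8; Const 9 1].

(** Index m of a cycle is stored at its head, not at the end of its run. Hence each arc is copied as
    a range followed by the head, and the chord b_1, b_0 is written apart. [Add 13 11 14] yields
    start + k + (k-1), the last letter of the pending cycle. *)
Definition even_cycle2 :=
  blk [:: Add 12 11 1; Sub 14 11 10; Sub 14 14 1; copy_range; pushA 10;
          Add 12 6 1; pushA 12; pushA 11;
          Add 12 7 1; Sub 14 7 6; Sub 14 14 1; copy_range; pushA 6; closeA;
          Add 12 10 1; Sub 14 11 10; Sub 14 14 1; Add 13 11 14; copy_pairs;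
          Add 12 6 1; pushB 12; pushB 6; closeB;
          Add 12 12 1; Sub 14 7 6; Sub 14 14 1; Sub 13 2 1; copy_pairs;
          Const 9 0].

Definition do_cycle :=
  blk [:: Const 8 0; Add 6 2 8; Add 7 2 8; scan_cycle;
          If 8 odd_cycle (If 9 even_cycle2 even_cycle1);
          Add 2 2 1; Read 3 0 2].

Definition commutator_prog := blk [:: Const 1 1; Read 3 0 2; While 3 do_cycle].

(** * Correctness and cost of the elementary loops *)

Section Program.

Variables (w n : nat) (W : seq nat).
Hypothesis W_lt : forall i, nth 0 W i < 2 ^ w.

(** Builds in the invariants that variable 1 is 1 and that variables 4 and 5 are the lengths of the
    two outputs. *)
Local Notation mem i v A B s h q g ps ph x y l :=
  (st [:: n; 1; i; v; size A; size B; s; h; q; g; ps; ph; x; y; l] [:: W; A; B]).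

Lemma size_flatten_triples (F G : nat -> nat) r :
  size (flatten [seq [:: F j; G j; 0] | j <- r]) = 3 * size r.
Proof. by elim: r => //= j r ->; rewrite mulnS. Qed.

Ltac arith := rewrite ?(size_flatten_triples, size_rcons, size_cat, size_map, size_iota) /=; lia.

Lemma set_nth_size (s : seq nat) v : set_nth 0 s (size s) v = rcons s v.
Proof. by elim: s => //= x s ->. Qed.

Ltac simp := cbn [set_nth nth].
Ltac aid := simp; first [exact: W_lt | arith].

Lemma runs_pushA z l i v A B s h q g ps ph x y c T Q : (size A).+1 < 2 ^ w ->
  let u := nth 0 W (nth 0 [:: n; 1; i; v; size A; size B; s; h; q; g; ps; ph; x; y; c] z) in
  runs w (blk l) (mem i u (rcons A u) B s h q g ps ph x y c) T Q ->
  runs w (blk (pushA z :: l)) (mem i v A B s h q g ps ph x y c) (4 + T) Q.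
Proof.
move=> ltA u r.
apply: (runs_cons (R := eq _)) => [|_ <-]; last exact: r.
apply: runs_read; first exact: W_lt.
apply: runs_write; first exact: W_lt.
apply: runs_add; first by simp; lia.
by apply: runs_nil; simp; rewrite set_nth_size size_rcons addn1.
Qed.

Lemma runs_pushB z l i v A B s h q g ps ph x y c T Q : (size B).+1 < 2 ^ w ->
  let u := nth 0 W (nth 0 [:: n; 1; i; v; size A; size B; s; h; q; g; ps; ph; x; y; c] z) in
  runs w (blk l) (mem i u A (rcons B u) s h q g ps ph x y c) T Q ->
  runs w (blk (pushB z :: l)) (mem i v A B s h q g ps ph x y c) (4 + T) Q.
Proof.
move=> ltB u r.
apply: (runs_cons (R := eq _)) => [|_ <-]; last exact: r.
apply: runs_read; first exact: W_lt.
apply: runs_write; first exact: W_lt.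
apply: runs_add; first by simp; lia.
by apply: runs_nil; simp; rewrite set_nth_size size_rcons addn1.
Qed.

Lemma runs_closeA l i v A B s h q g ps ph x y c T Q : (size A).+1 < 2 ^ w ->
  runs w (blk l) (mem i 0 (rcons A 0) B s h q g ps ph x y c) T Q ->
  runs w (blk (closeA :: l)) (mem i v A B s h q g ps ph x y c) (4 + T) Q.
Proof.
move=> ltA r.
apply: (runs_cons (R := eq _)) => [|_ <-]; last exact: r.
apply: runs_const; first by lia.
apply: runs_write; first by simp; lia.
apply: runs_add; first by simp; lia.
by apply: runs_nil; simp; rewrite set_nth_size size_rcons addn1.
Qed.

Lemma runs_closeB l i v A B s h q g ps ph x y c T Q : (size B).+1 < 2 ^ w ->
  runs w (blk l) (mem i 0 A (rcons B 0) s h q g ps ph x y c) T Q ->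
  runs w (blk (closeB :: l)) (mem i v A B s h q g ps ph x y c) (4 + T) Q.
Proof.
move=> ltB r.
apply: (runs_cons (R := eq _)) => [|_ <-]; last exact: r.
apply: runs_const; first by lia.
apply: runs_write; first by simp; lia.
apply: runs_add; first by simp; lia.
by apply: runs_nil; simp; rewrite set_nth_size size_rcons addn1.
Qed.

(** The continuation is quantified over [v'] because the final content of variable 3 depends on
    whether the loop body ran at all. *)
Lemma runs_copy_range l i v A B s h q g ps ph x y c T Q :
  size A + c < 2 ^ w -> (x + c).+1 < 2 ^ w ->
  (forall v', runs w (blk l)
     (mem i v' (A ++ [seq nth 0 W j | j <- iota x c]) B s h q g ps ph (x + c) y 0) T Q) ->
  runs w (blk (copy_range :: l)) (mem i v A B s h q g ps ph x y c) (8 * c + 1 + T) Q.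
Proof.
move=> ltA ltx r.
apply: (runs_cons (R := fun s' => exists v', s' =
  mem i v' (A ++ [seq nth 0 W j | j <- iota x c]) B s h q g ps ph (x + c) y 0)) => [|_ [v' ->]];
  last exact: r.
elim: c v A x ltA ltx {r} => [|c IH] v A x ltA ltx.
  by apply: runs_while0 => //; exists v; rewrite /= cats0 addn0.
(* One round costs 8: the test, 4 for the push with its closing [Skip], two updates and another
   [Skip]. *)
apply: (runs_le (T := (4 + (1).+2 + (8 * c + 1)).+1)); last by lia.
apply: (runs_while (R := eq _)) => [//||_ <-].
  apply: runs_pushA; first by lia.
  apply: runs_add; first by simp; lia.
  apply: runs_sub; first by simp; lia.
  by apply: runs_nil; simp.
rewrite /= subn1 addn1; apply: runs_imp (IH _ (rcons A _) x.+1 _ _) _; try arith.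
by move=> _ [v' ->]; exists v'; rewrite cat_rcons addSnnS.
Qed.

Lemma runs_copy_pairs l i v A B s h q g ps ph x y c T Q :
  size B + 3 * c < 2 ^ w -> (x + c).+1 < 2 ^ w -> y < 2 ^ w ->
  (forall v', runs w (blk l)
     (mem i v' A (B ++ flatten [seq [:: nth 0 W (x + j); nth 0 W (y - j); 0] | j <- iota 0 c])
        s h q g ps ph (x + c) (y - c) 0) T Q) ->
  runs w (blk (copy_pairs :: l)) (mem i v A B s h q g ps ph x y c) (18 * c + 1 + T) Q.
Proof.
move=> ltB ltx lty r.
apply: (runs_cons (R := fun s' => exists v', s' =
  mem i v' A (B ++ flatten [seq [:: nth 0 W (x + j); nth 0 W (y - j); 0] | j <- iota 0 c])
        s h q g ps ph (x + c) (y - c) 0)) => [|_ [v' ->]];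
  last exact: r.
elim: c v B x y ltB ltx lty {r} => [|c IH] v B x y ltB ltx lty.
  by apply: runs_while0 => //; exists v; rewrite /= cats0 addn0 subn0.
apply: (runs_le (T := (4 + (4 + (4 + (1).+3)) + (18 * c + 1)).+1)); last by lia.
apply: (runs_while (R := eq _)) => [//||_ <-].
  apply: runs_pushB; first by lia.
  apply: runs_pushB; first by arith.
  apply: runs_closeB; first by arith.
  apply: runs_add; first by simp; lia.
  apply: runs_sub; first by simp; lia.
  apply: runs_sub; first by simp; lia.
  by apply: runs_nil; simp.
rewrite /= !subn1 addn1;
apply: runs_imp (IH _ (rcons (rcons (rcons B _) _) _) x.+1 _ _ _ _) _; try arith.
move=> _ [v' ->]; exists v'; rewrite -!cats1 -!catA /= addn0 subn0.
rewrite (iotaDl 1 0 c : iota 1 c = _) -map_comp addSnnS subnS -predn_sub /=.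
congr (mem _ _ _ (B ++ [:: _, _, _ & flatten _]) _ _ _ _ _ _ _ _ _);
  by apply: eq_map => j /=; rewrite addSnnS add1n subnS -predn_sub.
Qed.

(** The induction needs an arbitrary initial parity q: after m toggles the middle has advanced by
    [(q + m)./2]. *)
Lemma runs_scan_cycle l i v A B s h q g ps ph x y c m T Q :
  v = nth 0 W i -> (forall j, j < m -> 0 < nth 0 W (i + j)) -> nth 0 W (i + m) = 0 ->
  i + m < 2 ^ w -> h + m < 2 ^ w -> q < 2 -> 1 < 2 ^ w ->
  runs w (blk l)
     (mem (i + m) 0 A B s (h + (q + m)./2) (odd (q + m) : nat) g ps ph x y c) T Q ->
  runs w (blk (scan_cycle :: l)) (mem i v A B s h q g ps ph x y c) (8 * m + 1 + T) Q.
Proof.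
move=> vE Wpos W0 lti lth ltq lt1 r.
apply: (runs_cons (R := eq _)) => [|_ <-]; last exact: r.
elim: m i v h q {r} vE Wpos W0 lti lth ltq => [|m IH] i v h q vE Wpos W0 lti lth ltq.
  rewrite addn0 in W0; apply: runs_while0; first by rewrite /= vE.
  by rewrite vE W0 !addn0; case: q ltq => [|[]] //; rewrite addn0.
apply: (runs_le (T := ((3.+1 + 2).+1 + (8 * m + 1)).+1)); last by lia.
apply: (runs_while (R := eq (mem (i + 1) (nth 0 W (i + 1)) A B s
  (h + q) (1 - q) g ps ph x y c))) => [||_ <-].
- by rewrite /= vE -[i]addn0 Wpos.
- apply: runs_add; first by simp; lia.
  simp; apply: (runs_cons (R := eq (mem (i + 1) v A B s
    (h + q) (1 - q) g ps ph x y c))) => [|_ <-]; last first.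
    apply: runs_read; first by exact: W_lt.
    by apply: (runs_le (runs_nil _ _)) => //; simp.
  apply: runs_if; simp => q0.
    have -> : q = 1 by lia.
    apply: runs_add; first by simp; lia.
    apply: runs_const; first by simp; lia.
    by apply: runs_nil; simp.
  rewrite q0 addn0; apply: (runs_le (T := 2)); last by [].
  apply: runs_const; first by simp; lia.
  by apply: runs_nil; simp.
- apply: runs_imp (IH _ _ _ _ _ _ _ _ _ _) _ => //; try lia.
  + by move=> j ltj; rewrite -addnA add1n Wpos.
  + by rewrite -addnA add1n.
  + have -> : h + q + (1 - q + m)./2 = h + (q + m.+1)./2 by lia.
    have -> : odd (1 - q + m) = odd (q + m.+1) by lia.
    by move=> _ <-; rewrite -addnA add1n.
Qed.

(** * Cycles as words, and the output of one block *)

Variables (T : eqType) (x0 : T) (f : T -> nat).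
Hypothesis f_gt0 : forall x, 0 < f x.

(** As [code], but without the final 0, so that words concatenate; positivity of [f] lets 0 serve as
    the separator. *)
Definition letters (cs : seq (seq T)) : seq nat :=
  flatten [seq rcons [seq f x | x <- c] 0 | c <- cs].

Definition stored s (c : seq T) :=
  forall j, j < size c -> nth 0 W (s + j) = f (pt x0 c j).

Lemma letters_cat cs1 cs2 : letters (cs1 ++ cs2) = letters cs1 ++ letters cs2.
Proof. by rewrite /letters map_cat flatten_cat. Qed.

Lemma stored_range s c a k : stored s c -> a + k <= size c ->
  [seq nth 0 W j | j <- iota (s + a) k] = [seq f x | x <- [seq pt x0 c j | j <- iota a k]].
Proof.
move=> sc lek; rewrite iotaDl -!map_comp; apply/eq_in_map => j.
by rewrite mem_iota => ltj; apply: sc; lia.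
Qed.

Lemma stored_arc s c : stored s c -> 0 < size c ->
  [seq f x | x <- arc x0 c] =
  rcons [seq nth 0 W j | j <- iota (s + (size c)./2 + 1) (size c).-1./2] (nth 0 W s).
Proof.
move=> sc c0; rewrite /arc (_ : uphalf (size c) = (size c).-1./2 + 1); last lia.
rewrite iotaD map_cat map_cat -addnA (stored_range sc); last lia.
rewrite cats1 addn1 /= (_ : _ + _ = size c); last lia.
by rewrite pt_size -sc // addn0.
Qed.

(** The lower limit a is 1 for s = m, but 2 for s = m+1, where the first chord involves index m,
    whose letter is read at the head. *)
Lemma stored_chords s c a k : stored s c ->
    a + (k.-1./2.+1 - a) <= size c -> k - a < size c -> a <= k ->
  letters [seq [:: pt x0 c j; pt x0 c (k - j)] | j <- iota a (k.-1./2.+1 - a)] =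
  flatten [seq [:: nth 0 W (s + a + j); nth 0 W (s + (k - a) - j); 0]
          | j <- iota 0 (k.-1./2.+1 - a)].
Proof.
move=> sc lek ltk leak; congr flatten.
rewrite -{1}[a]addn0 iotaDl -!map_comp; apply/eq_in_map => j.
rewrite mem_iota => ltj /=; rewrite -!addnA -addnBA; last lia.
by rewrite !sc ?subnDA //; lia.
Qed.

Lemma stored_chords_size s c : stored s c ->
  letters (chords x0 c (size c)) =
  flatten [seq [:: nth 0 W (s + 1 + j); nth 0 W (s + (size c - 1) - j); 0]
          | j <- iota 0 (size c).-1./2].
Proof.
move=> sc; case: (posnP (size c)) => [c0|c0]; first by rewrite /chords c0.
by have := stored_chords (a := 1) (k := size c) sc; rewrite subn1 /=; apply; lia.
Qed.

Lemma stored_chords_sizeS s c : stored s c -> 0 < size c -> ~~ odd (size c) ->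
  letters (chords x0 c (size c).+1) =
  [:: nth 0 W (s + 1), nth 0 W s, 0 &
    flatten [seq [:: nth 0 W (s + 2 + j); nth 0 W (s + (size c - 1) - j); 0]
            | j <- iota 0 (size c).-1./2]].
Proof.
move=> sc c0 oc; have := stored_chords (a := 2) (k := (size c).+1) sc.
rewrite /= !subSS (_ : (size c)./2 - 1 = (size c).-1./2); last lia.
move=> <-; [|lia..].
rewrite /chords (_ : (size c).+1.-1./2 = ((size c).-1./2).+1); last lia.
by rewrite /letters /= subn1 /= pt_size -!sc ?addn0 //; lia.
Qed.

Lemma runs_odd_cycle v A B s q g ps ph x y l c :
    stored s c -> odd (size c) ->
    size A + 3 * size c < 2 ^ w -> size B + 3 * size c < 2 ^ w ->
    s + size c + 1 < 2 ^ w ->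
  runs w odd_cycle (mem (s + size c) v A B s (s + (size c)./2) q g ps ph x y l)
    (18 * size c + 30)
    (fun s' => exists v x y, s' = mem (s + size c) v
       (A ++ letters [:: arc x0 c]) (B ++ letters (chords x0 c (size c)))
       s (s + (size c)./2) q g ps ph x y 0).
Proof.
move=> sc oc ltA ltB lts.
(* The bound is left open: it accumulates during the symbolic execution and is compared with the
   claim at the end. *)
eapply runs_le.
  eapply runs_add; first by aid.
  simp; eapply runs_sub; first by aid.
  simp; rewrite addKn; eapply runs_copy_range; [aid..|move=> v1].
  eapply runs_pushA; first by aid.
  simp; eapply runs_closeA; first by aid.
  eapply runs_add; first by aid.
  simp; eapply runs_sub; first by aid.
  simp; eapply runs_sub; first by aid.
  simp; rewrite addKn; eapply runs_copy_pairs; [aid..|move=> v2].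
  apply: runs_nil; do 3!eexists.
  rewrite (stored_chords_size sc) /letters /= cats0 (stored_arc sc); last by lia.
  rewrite (_ : (size c).-1./2 = (size c)./2); last lia.
  by rewrite !rcons_cat -addnBA //; lia.
lia.
Qed.

Lemma runs_even_cycle2 v A B s q ps x y l a b :
    stored ps a -> stored s b -> ~~ odd (size a) -> ~~ odd (size b) ->
    0 < size a -> 0 < size b ->
    size A + 3 * size a + 3 * size b < 2 ^ w ->
    size B + 3 * size a + 3 * size b < 2 ^ w ->
    s + size b + 1 < 2 ^ w -> ps + size a + 1 < 2 ^ w ->
  runs w even_cycle2 (mem (s + size b) v A B s (s + (size b)./2) q 1 ps (ps + (size a)./2) x y l)
    (18 * size a + 18 * size b + 60)
    (fun s' => exists v x y, s' = mem (s + size b) v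
       (A ++ letters [:: alpha_cycle x0 [:: a; b]])
       (B ++ letters (beta_cycles x0 [:: a; b]))
       s (s + (size b)./2) q 0 ps (ps + (size a)./2) x y 0).
Proof.
move=> sa sb oa ob a0 b0 ltA ltB lts ltps.
have ha : (size a)./2 - 1 = (size a).-1./2 by lia.
have hb : (size b)./2 - 1 = (size b).-1./2 by lia.
eapply runs_le.
  eapply runs_add; first by aid.
  simp; eapply runs_sub; first by aid.
  simp; rewrite addKn; eapply runs_sub; first by aid.
  simp; rewrite ha; eapply runs_copy_range; [aid..|move=> v1].
  eapply runs_pushA; first by aid.
  simp; eapply runs_add; first by aid.
  simp; eapply runs_pushA; first by aid.
  simp; eapply runs_pushA; first by aid.
  simp; eapply runs_add; first by aid.
  simp; eapply runs_sub; first by aid.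
  simp; rewrite addKn; eapply runs_sub; first by aid.
  simp; rewrite hb; eapply runs_copy_range; [aid..|move=> v2].
  eapply runs_pushA; first by aid.
  simp; eapply runs_closeA; first by aid.
  eapply runs_add; first by aid.
  simp; eapply runs_sub; first by aid.
  simp; rewrite addKn; eapply runs_sub; first by aid.
  simp; rewrite ha; eapply runs_add; first by aid.
  simp; eapply runs_copy_pairs; [aid..|move=> v3].
  eapply runs_add; first by aid.
  simp; eapply runs_pushB; first by aid.
  simp; eapply runs_pushB; first by aid.
  simp; eapply runs_closeB; first by aid.
  eapply runs_add; first by aid.
  simp; eapply runs_sub; first by aid.
  simp; rewrite addKn; eapply runs_sub; first by aid.
  simp; rewrite hb; eapply runs_sub; first by aid.
  simp; eapply runs_copy_pairs; [aid..|move=> v4].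
  eapply runs_const; first by aid.
  apply: runs_nil; simp; do 3!eexists.
  set A1 := rcons _ 0; set B1 := _ ++ flatten _.
  have -> : A1 = A ++ letters [:: alpha_cycle x0 [:: a; b]].
    rewrite /A1 /letters /= cats0 map_cat (stored_arc sa) //= (stored_arc sb) //.
    rewrite sb; last lia.
    rewrite sa; last lia.
    by rewrite -!cats1 -!catA /= -!catA.
  have -> : B1 = B ++ letters (beta_cycles x0 [:: a; b]).
    rewrite /B1 letters_cat.
    rewrite (stored_chords_size sa) (stored_chords_sizeS sb) //.
    rewrite -!cats1 -!catA /=.
    rewrite (_ : ps + _ + _ = ps + (size a - 1)); last lia.
    rewrite (_ : s + 1 + 1 = s + 2); last lia.
    rewrite (_ : s + size b - 1 = s + (size b - 1)); last lia.
    by [].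
  by [].
lia.
Qed.

(** * The main loop and its amortised cost *)

Definition pending_size (p : option (seq T)) := if p is Some a then size a else 0.

Definition next_pending (p : option (seq T)) c :=
  if odd (size c) then p else if p is Some _ then None else Some c.

Definition holds_pending (p : option (seq T)) g ps ph :=
  if p is Some a then
    [/\ g = 1, stored ps a, even_cycle a, ph = ps + (size a)./2
      & ps + size a + 1 < 2 ^ w]
  else g = 0.

(** This bound and its analogue for beta ensure that the output lengths fit in a word. *)
Lemma size_letters_alpha bl :
  block bl -> size (letters [:: alpha_cycle x0 bl]) <= 3 * size (flatten bl).
Proof.
rewrite /letters /= cats0 size_rcons size_map.
case: bl => [|a [|b []]] //=; rewrite ?cats0 ?size_cat /= !size_arc; lia.
Qed.

Lemma size_letters_chords c k : size (letters (chords x0 c k)) = 3 * k.-1./2.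
Proof.
rewrite /chords -{2}(size_iota 1 k.-1./2).
by elim: (iota _ _) => //= j r IH; rewrite mulnS -IH.
Qed.

Lemma size_letters_beta bl :
  block bl -> size (letters (beta_cycles x0 bl)) <= 3 * size (flatten bl).
Proof.
case: bl => [|a [|b []]] //=; rewrite cats0 ?letters_cat ?size_cat !size_letters_chords; lia.
Qed.

(** The invariant equates the output so far, followed by the output of the blocks to come, before
    and after the cycle. In the size bounds a pending cycle reserves three cells per point. [letter]
    leaves variable 3 free after the branch and fixes it after the final read. *)
Definition cycle_done p c A B i (letter : nat -> Prop) s' :=
  let p' := next_pending p c in
  exists v A' B' s0 h q g ps ph x y l,
  [/\ s' = mem i v A' B' s0 h q g ps ph x y l /\ letter v,
      holds_pending p' g ps ph,
      forall cs,
        A' ++ letters [seq alpha_cycle x0 bl | bl <- blocks p' cs] =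
        A ++ letters [seq alpha_cycle x0 bl | bl <- blocks p (c :: cs)],
      forall cs,
        B' ++ letters (flatten [seq beta_cycles x0 bl | bl <- blocks p' cs]) =
        B ++ letters (flatten [seq beta_cycles x0 bl | bl <- blocks p (c :: cs)])
    & size A' + 3 * pending_size p' <=
        size A + 3 * pending_size p + 3 * size c /\
      size B' + 3 * pending_size p' <=
        size B + 3 * pending_size p + 3 * size c].

Lemma runs_do_cycle A B s s0 h q g ps ph x y l p c :
    stored s c -> nth 0 W (s + size c) = 0 -> 0 < size c ->
    holds_pending p g ps ph ->
    size A + 3 * pending_size p + 3 * size c < 2 ^ w ->
    size B + 3 * pending_size p + 3 * size c < 2 ^ w ->
    s + 2 * size c + 2 < 2 ^ w ->
  runs w do_cycle (mem s (nth 0 W s) A B s0 h q g ps ph x y l)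
    (26 * size c + (if odd (size c) then 0 else 18 * pending_size p) + 80)
    (cycle_done p c A B (s + size c + 1) (eq (nth 0 W (s + size c + 1)))).
Proof.
move=> sc W0 c0 pP ltA ltB lts.
eapply runs_le.
  eapply runs_const; first by aid.
  simp; eapply runs_add; first by aid.
  simp; eapply runs_add; first by aid.
  simp; rewrite addn0; eapply (runs_scan_cycle (m := size c)) => //; try lia.
    by move=> j ltj; rewrite sc.
  rewrite add0n.
  eapply (runs_cons (R := cycle_done p c A B (s + size c) xpredT)).
    apply: (runs_le (T := (18 * size c +
      (if odd (size c) then 0 else 18 * pending_size p) + 61).+1));
      last exact: leqnn.
    apply: runs_if; simp.
      case: (boolP (odd (size c))) => oc // _.
      apply: (@runs_le _ _ _ (18 * size c + 30)); last by lia.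
      eapply runs_imp; first by apply: runs_odd_cycle sc oc _ _ _; lia.
      move=> _ [v' [x' [y' ->]]]; do 12!eexists; rewrite /next_pending oc.
      have bc : block [:: c] by [].
      split=> //= [cs|cs|].
      + by rewrite oc -catA -letters_cat.
      + by rewrite oc -catA -letters_cat.
      + have := size_letters_alpha bc; have := size_letters_beta bc.
        rewrite /= cats0 !size_cat; lia.
    case: (boolP (odd (size c))) => oc // _.
    apply: (@runs_le _ _ _ (18 * size c + 18 * pending_size p + 60).+1); last by lia.
    apply: runs_if; simp => g0.
      case: p pP ltA ltB => [a|] /=; last by lia.
      move=> [-> sa /andP[oa a0] -> ltps] ltA ltB.
      apply: (@runs_le _ _ _ (18 * size a + 18 * size c + 60)); last by lia.
      eapply runs_imp; first by apply: runs_even_cycle2 sa sc oa oc a0 c0 _ _ _ _; lia.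
      move=> _ [v' [x' [y' ->]]]; do 12!eexists; rewrite /next_pending (negbTE oc).
      have bc : block [:: a; c] by rewrite /= oa oc a0 c0.
      split=> //= [cs|cs|].
      + by rewrite (negbTE oc) -catA -letters_cat.
      + by rewrite (negbTE oc) -catA -letters_cat.
      + have := size_letters_alpha bc; have := size_letters_beta bc.
        rewrite /= cats0 !size_cat; lia.
    case: p pP ltA ltB => [a [g1]|_ ltA ltB]; first by lia.
    apply: (@runs_le _ _ _ 4); last by lia.
    eapply runs_add; first by aid.
    simp; eapply runs_add; first by aid.
    simp; eapply runs_const; first by aid.
    simp; apply: runs_nil; do 12!eexists; rewrite /next_pending (negbTE oc).
    split=> //= [|cs|cs|]; rewrite ?(negbTE oc) //; last by lia.
    by split; rewrite ?addn0 ?/even_cycle ?oc //; lia.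
  move=> _ [v [A' [B' [s0' [h' [q' [g' [ps' [ph' [x' [y' [l'
    [[-> _] pP' EA EB [leA leB]]]]]]]]]]]]]].
  eapply runs_add; first by aid.
  simp; eapply runs_read; first by aid.
  simp; apply: runs_nil; do 12!eexists; split; [split; reflexivity|eassumption|..] => //.
by case: odd; lia.
Qed.

Lemma runs_cycles cs pre A B s0 h q g ps ph x y l p :
    W = pre ++ rcons (letters cs) 0 -> [::] \notin cs ->
    holds_pending p g ps ph ->
    size A + 3 * pending_size p + 3 * size (letters cs) < 2 ^ w ->
    size B + 3 * pending_size p + 3 * size (letters cs) < 2 ^ w ->
    2 * size W + 4 < 2 ^ w ->
  runs w (While 3 do_cycle)
    (mem (size pre) (nth 0 W (size pre)) A B s0 h q g ps ph x y l)
    (130 * size (letters cs) + 18 * pending_size p + 1)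
    (fun s' => exists vs, s' = st vs [:: W;
       A ++ letters [seq alpha_cycle x0 bl | bl <- blocks p cs];
       B ++ letters (flatten [seq beta_cycles x0 bl | bl <- blocks p cs])]).
Proof.
elim: cs pre A B s0 h q g ps ph x y l p =>
  [|c cs IH] pre A B s0 h q g ps ph x y l p WE cs0 pP ltA ltB ltW.
  apply: (@runs_le _ _ _ 1); last by lia.
  apply: runs_while0; first by rewrite /= WE nth_cat ltnn subnn.
  by eexists; rewrite /= !cats0.
move: cs0; rewrite inE negb_or => /andP[c0 cs0].
have {}c0 : 0 < size c by rewrite lt0n size_eq0 eq_sym.
have lE : letters (c :: cs) = rcons [seq f z | z <- c] 0 ++ letters cs by [].
have sl : size (letters (c :: cs)) = size c + 1 + size (letters cs).
  by rewrite lE size_cat size_rcons size_map; lia.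
have sW : size W = size pre + size (letters (c :: cs)) + 1.
  by rewrite WE size_cat size_rcons; lia.
have sc : stored (size pre) c.
  move=> j ltj; rewrite WE lE nth_cat ltnNge leq_addr addKn /= rcons_cat nth_cat.
  rewrite size_rcons size_map ltnS (ltnW ltj) nth_rcons size_map ltj.
  by rewrite (nth_map (head x0 c)).
have W0 : nth 0 W (size pre + size c) = 0.
  rewrite WE lE nth_cat ltnNge leq_addr addKn /= rcons_cat nth_cat.
  by rewrite size_rcons size_map leqnn nth_rcons size_map ltnn eqxx.
rewrite sl in ltA ltB sW.
(* The fixed cost of a round is charged to the letters of its cycle. A cycle that becomes pending
   stores a potential of 18 per point, spent when its partner arrives. *)
apply: (runs_le (T := ((26 * size c + (if odd (size c) then 0 else 18 * pending_size p) + 80) +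
  (130 * size (letters cs) + 18 * pending_size (next_pending p c) + 1)).+1)); last first.
  by rewrite sl /next_pending; case: ifP => _; case: (p) => [a|] /=; lia.
apply: runs_while.
- by rewrite /= -[size pre]addn0 sc.
- by apply: runs_do_cycle pP _ _ _ => //; lia.
move=> _ [v [A' [B' [s0' [h' [q' [g' [ps' [ph' [x' [y' [l'
  [[-> <-] pP' EA EB [leA leB]]]]]]]]]]]]]].
rewrite -EA -EB.
have -> : size pre + size c + 1 = size (pre ++ rcons [seq f z | z <- c] 0).
  by rewrite size_cat size_rcons size_map; lia.
apply: IH => //; try lia.
by rewrite WE lE rcons_cat catA.
Qed.

End Program.

(** * Word sizes and assembly *)

(** Cycles are nonempty, so there are at most as many closing zeros as points, and one 0 ends the
    word. *)
Lemma size_code n (cs : seq (seq 'I_n)) :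
  [::] \notin cs -> uniq (flatten cs) -> size (code cs) <= 2 * n + 1.
Proof.
move=> cs0 Ucs; have : size (flatten cs) <= n.
  by rewrite -[n in leqRHS]card_ord -(card_uniqP Ucs) max_card.
suff : size (code cs) <= 2 * size (flatten cs) + 1 by lia.
rewrite /code size_rcons {Ucs}; elim: cs cs0 => //= c cs IH.
rewrite inE negb_or => /andP[c0 /IH].
rewrite !size_cat size_rcons size_map.
by case: c c0 => //= x c _; lia.
Qed.

Lemma code_leq n (cs : seq (seq 'I_n)) i : nth 0 (code cs) i <= n.
Proof.
case: (ltnP i (size (code cs))) => [lti|lei]; last by rewrite nth_default.
have := mem_nth 0 lti; move: (nth _ _ _) => v.
rewrite mem_rcons inE => /orP[/eqP->//|/flatten_mapP[c _]].
by rewrite mem_rcons inE => /orP[/eqP->//|/mapP[x _ ->]]; exact: ltn_ord x.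
Qed.

(** The program never writes the 0 that ends a word: it is the initial value of the first cell past
    the output. *)
Lemma holds_code n (cs : seq (seq 'I_n)) s a :
  arr s a = nth 0 (letters (fun x : 'I_n => (val x).+1) cs) -> holds s a (code cs).
Proof.
rewrite /holds => ->; apply: (@eq_from_nth _ 0); rewrite size_mkseq // => i lti.
rewrite nth_mkseq // /code nth_rcons -/(letters _ _).
by case: ltngtP => [//|h|->]; apply: nth_default => //; apply: ltnW.
Qed.

Lemma init_stateE n s :
  init_state n s = st [:: n; 0; 0; 0; 0; 0; 0; 0; 0; 0; 0; 0; 0; 0; 0] [:: s; [::]; [::]].
Proof.
rewrite /init_state /st; congr State; apply: functional_extensionality.
  by do 15?case=> //=; move=> m; rewrite nth_nil.
move=> a; apply: functional_extensionality => i.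
by case: a => [|[|[|a]]] //=; rewrite !nth_nil.
Qed.

(** Here n+1 <= 2^(bits n), and the factor 16 = 2^4 is absorbed by four more copies of [bits n],
    each at least 1. *)
Lemma word_bound n : 0 < n -> 16 * n.+1 <= 2 ^ (5 * bits n).
Proof.
move=> n0; have lt : n < 2 ^ bits n by apply: trunc_log_ltn.
apply: (@leq_trans (2 ^ (4 + bits n))); last by rewrite leq_exp2l // /bits; lia.
by rewrite expnD leq_mul.
Qed.

(* One program p for all n, running in time at most C * n with words of
   O(log n) bits; its results are left in arrays 1 and 2. *)
Theorem mainTheorem3 :
  exists (p : prog) (C d : nat),
  forall (n : nat) (sigma : 'S_n) (cs : seq (seq 'I_n)),
    0 < n -> (sigma \in 'Alt_('I_n))%g -> cycle_notation cs sigma ->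
    exists (alpha beta : 'S_n) (cs_alpha cs_beta : seq (seq 'I_n))
           (t : nat) (st : state),
      [/\ exec (d * bits n) p (init_state n (code cs)) t st,
          t <= C * n,
          cycle_notation cs_alpha alpha /\ holds st 1 (code cs_alpha),
          cycle_notation cs_beta beta /\ holds st 2 (code cs_beta)
        & sigma = pcommutator alpha beta].
Proof.
(* At most 2n letters at 130 units each, plus 4 units of overhead, give 264 n since n >= 1; the 5 is
   that of [word_bound]. *)
exists commutator_prog, 264, 5 => n sigma cs n0 sigma_even csP.
pose x0 := Ordinal n0; pose f (x : 'I_n) := (val x).+1.
have [alpha [beta [aP bP abP]]] := cycle_notation_commutator x0 sigma_even csP.
have [cs0 Ucs _ _] := csP.
have szW := size_code cs0 Ucs; have lw := word_bound n0.
set w := 5 * bits n in lw *.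
have W_lt i : nth 0 (code cs) i < 2 ^ w.
  by apply: leq_ltn_trans (code_leq cs i) _; lia.
pose L := size (letters f cs).
have szL : size (code cs) = L.+1 by rewrite size_rcons.
have : runs w commutator_prog (init_state n (code cs)) (264 * n)
    (fun s' => exists vs, s' = st vs [:: code cs;
       letters f (alpha_cycles x0 cs); letters f (all_beta_cycles x0 cs)]).
  rewrite init_stateE; eapply runs_le.
    eapply runs_const; first by lia.
    eapply runs_read; first exact: W_lt.
    cbn [set_nth nth]; eapply runs_cons; last by move=> s Hs; exact: runs_nil Hs.
    have f_gt0 x : 0 < f x by [].
    by apply: (runs_cycles n W_lt f_gt0 (x0 := x0) (cs := cs) (pre := [::])
      (A := [::]) (B := [::]) 0 0 0 0 0 0 (p := None)) => //=; rewrite -?/L; lia.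
  by rewrite /= -/L; lia.
move=> [t [s [e let_ [vs sE]]]].
exists alpha, beta, (alpha_cycles x0 cs), (all_beta_cycles x0 cs), t, s.
by split=> //; split=> //; apply: holds_code; rewrite sE.
Qed.
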